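(* Let $m\geqslant 3$ and let $c_1,\ldots,c_m$ and $g\geqslant 2$ be integers. Then, as $N\to\infty$, $$\#\Big\{n\leqslant N:\ n^2=\sum_{i=1}^m c_i g^{k_i}\ \text{for some}\ k_1,\ldots,k_m\in\mathbb{Z}\Big\}\leqslant (\log N)^{m-\gamma_m+o(1)},$$ where $n$ ranges over positive integers, and $$\gamma_3=\frac{677}{1969}\qquad\text{and}\qquad \gamma_m=\frac{677m}{1323m+1354}\quad\text{for } m\geqslant 4.$$
   Context: Here $o(1)$ denotes a quantity tending to $0$ as $N\to\infty$ (for fixed $m$, $g$, $c_1,\ldots,c_m$). *)

(* Defs.v *)
From HB Require Import structures.
From mathcomp Require Import all_boot all_order all_algebra.
From mathcomp Require Import all_classical all_reals all_analysis.

Set Implicit Arguments.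
Unset Strict Implicit.
Unset Printing Implicit Defensive.

Import Order.TTheory GRing.Theory Num.Theory.

Local Open Scope ring_scope.

(* The exponents may be negative, so the equation is stated in rat; [^] is the
   integer power [exprz]. *)
Definition sparse_square (m : nat) (c : 'I_m -> int) (g : int) (n : nat) : Prop :=
  exists k : 'I_m -> int,
    (n%:R : rat) ^+ 2 = \sum_(i < m) (c i)%:~R * (g%:~R : rat) ^ (k i).

Definition sparse_square_count (m : nat) (c : 'I_m -> int) (g : int) (N : nat) : nat :=
  #|[set n : 'I_N.+1 | (0 < n)%N && `[< sparse_square c g n >]]|.

Definition gamma_exp (R : realType) (m : nat) : R :=
  if m == 3%N then 677%:R / 1969%:R
  else (677%:R * m%:R) / (1323%:R * m%:R + 1354%:R).

(* Main.v *)
Require Import Defs.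
From HB Require Import structures.
From mathcomp Require Import all_boot all_order all_algebra.
From mathcomp Require Import all_classical all_reals all_analysis.
From mathcomp Require Import zify ring lra.

(* A minimal subset of the terms that still represents n^2 has no vanishing
   subsum.  Hence all its exponents lie in a window of length O(log N): the terms
   beyond a long stretch free of exponents, above the size of n^2 or below 0,
   would have a nonzero sum too large, or too small, to be compensated.  Factoring
   out the least exponent h and the gap t to the next one, n^2 becomes
   g^h (c + g^t B).  For fixed h, c and B there are only O(log log N) values
   of t: if y1^2 = c + g^t1 B and y2^2 = c + g^(t1 + 2d) B, then
     (y1 g^d - y2) (y1 g^d + y2) = c (g^(2d) - 1)
   is nonzero, so y1 <= |c| g^d, and hence t2 >= 2 t1 - O(1).  The remaining
   data h, B range over O((log N)^(m-1)) possibilities, and log log N is absorbed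
   into (log N)^(1/3), which gives the exponent m - 2/3 (gamma_m < 2/3).  The error
   term o(1) can be taken to be 0. *)

Import Order.TTheory GRing.Theory Num.Theory.
Import numFieldNormedType.Exports.

Set Implicit Arguments.
Unset Strict Implicit.
Unset Printing Implicit Defensive.

Local Open Scope ring_scope.

(** * Sets of integers with doubling gaps *)

(** Each block from [C + 2 ^ n] up to [C + 2 ^ n.+1] holds at most one element of [S]: twice the
    smaller of two would exceed the larger plus [C]. Below [C + 1] every integer is allowed. *)
Lemma card_doubling (E C : nat) (S : {set 'I_E}) n :
  (forall s t : 'I_E, s \in S -> t \in S -> (s < t)%N -> (2 * s <= t + C)%N) ->
  (#|[set t in S | (t < C + 2 ^ n)%N]| <= C + 1 + n)%N.
Proof.
move=> gapS; elim: n => [|n IHn].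
  rewrite expn0 addn0.
  rewrite cardE -(size_map val) -[X in (_ <= X)%N](size_iota 0).
  apply: uniq_leq_size; first by rewrite map_inj_uniq ?enum_uniq //; exact: val_inj.
  move=> _ /mapP[t + ->]; rewrite mem_enum inE mem_iota => /andP[_].
  by rewrite add0n.
have -> : [set t in S | (t < C + 2 ^ n.+1)%N] =
    [set t in S | (t < C + 2 ^ n)%N]
    :|: [set t in S | (C + 2 ^ n <= t < C + 2 ^ n.+1)%N].
  apply/setP=> t; rewrite !inE -andb_orr; congr andb.
  have : (2 ^ n <= 2 ^ n.+1)%N by rewrite leq_exp2l.
  lia.
apply: (leq_trans (leq_card_setU _ _)); have -> : (C + 1 + n.+1 = C + 1 + n + 1)%N by lia.
apply: leq_add => //.
rewrite leqNgt; apply/negP => /card_gt1P [s [t []]].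
rewrite !inE expnS => /andP[sS /andP[s1 s2]] /andP[tS /andP[t1 t2]].
move=> /eqP st; have [lt|lt|eq] := ltngtP s t; last exact/st/val_inj.
- by have := gapS _ _ sS tS lt; lia.
- by have := gapS _ _ tS sS lt; lia.
Qed.

(** This is what lets the cube of a log log factor be absorbed into a single factor log. *)
Lemma cube_le_exp2 n : (n ^ 3 <= 4 * 2 ^ n)%N.
Proof.
have [|n4] := ltnP n 4; first by case: n => [|[|[|[|]]]].
rewrite -(subnK n4); elim: (n - 4)%N => // k IH.
rewrite addSn [X in (_ <= _ * X)%N]expnS.
apply: (@leq_trans (2 * (k + 4) ^ 3)%N); last by lia.
rewrite !expnSr !expn0; nia.
Qed.

(** * Squares sharing the same coefficients *)

(** In the application [P] is g^t1 and [G] is g^((t2 - t1) / 2). The difference of squares gives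
    [y1 <= |a| G]; since [b] is a nonzero integer, the first equation then bounds [P] by
    [y1 ^+ 2 + |a|]. *)
Lemma two_squares_bound (a b P G y1 y2 : int) :
  a != 0 -> b != 0 -> 0 < P -> 2 <= G -> 0 < y1 -> 0 < y2 ->
  y1 ^+ 2 = a + P * b -> y2 ^+ 2 = a + P * G ^+ 2 * b ->
  P <= 2 * `|a| ^+ 2 * G ^+ 2.
Proof.
move=> a0 b0 P0 G2 y1p y2p e1 e2.
have GG : 2 * 2 <= G ^+ 2 by rewrite expr2; apply: ler_pM.
have key : (y1 * G - y2) * (y1 * G + y2) = a * (G ^+ 2 - 1).
  have -> : (y1 * G - y2) * (y1 * G + y2) = y1 ^+ 2 * G ^+ 2 - y2 ^+ 2 by ring.
  by rewrite e1 e2; ring.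
have a1 : 1 <= `|a| by rewrite -gtz0_ge1 normr_gt0.
have y1le : y1 <= `|a| * G.
  have n0 : y1 * G - y2 != 0.
    apply/eqP => z0; move: key; rewrite z0 mul0r => /esym/eqP.
    by rewrite mulf_eq0 (negPf a0) /=; clear -GG; lia.
  have := congr1 Num.norm key; rewrite !normrM => key'.
  have n1 : 1 <= `|y1 * G - y2| by rewrite -gtz0_ge1 normr_gt0.
  have n2 : y1 * G <= `|y1 * G + y2|.
    have p1 : 0 < y1 * G by rewrite mulr_gt0 //; clear -G2; lia.
    by rewrite ger0_norm ?lerDl ?addr_ge0 // ltW.
  have n3 : `|G ^+ 2 - 1| <= G ^+ 2 by clear -GG; rewrite ger0_norm; lia.
  have n4 : y1 * G <= `|a| * G ^+ 2.
    apply: (le_trans n2); apply: le_trans (_ : `|a| * `|G ^+ 2 - 1| <= _).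
      by rewrite -key' ler_peMl.
    by rewrite ler_wpM2l.
  by move: n4; rewrite expr2 mulrA ler_pM2r //; clear -G2; lia.
have y1sq : y1 ^+ 2 <= `|a| ^+ 2 * G ^+ 2.
  by rewrite -exprMn lerXn2r // nnegrE ?mulr_ge0 //; clear -G2 y1p; lia.
have ag : `|a| * 1 <= `|a| ^+ 2 * G ^+ 2.
  apply: ler_pM => //; last by clear -GG; lia.
  by rewrite expr2 ler_peMl.
have : P <= y1 ^+ 2 + `|a|.
  (* For negative [b], the square [y1 ^+ 2] being nonnegative already forces [P <= a]. *)
  have [bp|bn] := ltP 0 b.
    have : P * 1 <= P * b by rewrite ler_pM2l //; clear -bp; lia.
    by rewrite e1; clear; lia.
  have : P * b <= P * (-1) by rewrite ler_pM2l //; clear -bn b0; lia.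
  have : 0 <= y1 ^+ 2 by exact: sqr_ge0.
  by rewrite e1; clear; lia.
by rewrite mulr1 in ag; clear -ag y1sq; lia.
Qed.

(** The additive constant must be independent of [h], which is why the even part of g^h is divided
    out first. Equal parity of [t1] and [t2] makes g^(t2 - t1) the square of an integer [G]. *)
Lemma square_gap (g h : nat) (c B : int) (t1 t2 x1 x2 : nat) :
  (2 <= g)%N -> c != 0 -> B != 0 -> (0 < x1)%N -> (0 < x2)%N ->
  (t1 < t2)%N -> odd t1 = odd t2 ->
  x1%:Z ^+ 2 = g%:Z ^+ h * (c + g%:Z ^+ t1 * B) ->
  x2%:Z ^+ 2 = g%:Z ^+ h * (c + g%:Z ^+ t2 * B) ->
  (2 * t1 <= t2 + (2 * `|c| + 3))%N.
Proof.
move=> g2 c0 B0 x1p x2p t12 todd.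
(* Dividing both numbers by [g ^ (h / 2)] leaves [h] equal to 0 or 1. *)
pose q := (h./2)%N.
have gp : (0 < g)%N by lia.
have red x t : (0 < x)%N -> x%:Z ^+ 2 = g%:Z ^+ h * (c + g%:Z ^+ t * B) ->
    exists2 y : nat, (0 < y)%N &
      y%:Z ^+ 2 = g%:Z ^+ odd h * c + g%:Z ^+ t * (g%:Z ^+ odd h * B).
  move=> xp ex.
  have hE : g%:Z ^+ h = (g%:Z ^+ q) ^+ 2 * g%:Z ^+ odd h.
    by rewrite -exprM -exprD muln2 addnC odd_double_half.
  have /dvdnP[y xE] : (g ^ q %| x)%N.
    rewrite -(@dvdn_pexp2r _ _ 2) //; apply/dvdnP.
    exists (absz (g%:Z ^+ odd h * (c + g%:Z ^+ t * B))).
    apply/eqP; rewrite -eqz_nat; apply/eqP.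
    move: ex; rewrite hE -mulrA => ex.
    have := congr1 absz ex; rewrite abszM !abszX !absz_nat => ->.
    by rewrite mulnC.
  exists y; first by move: xp; rewrite xE muln_gt0 => /andP[].
  have gq : (g%:Z ^+ q) ^+ 2 != 0 by rewrite -exprM expf_neq0 //; lia.
  apply: (mulfI gq); rewrite -exprMn.
  have -> : g%:Z ^+ q * y = x%:Z by rewrite xE -[RHS]natz natrM natrX !natz mulrC.
  by rewrite ex hE; ring.
move=> /(red _ _ x1p) [y1 y1p e1] /(red _ _ x2p) [y2 y2p e2].
move: e1 e2; set a := g%:Z ^+ odd h * c; set b := g%:Z ^+ odd h * B => e1 e2.
have go0 : g%:Z ^+ odd h != 0 by rewrite expf_neq0 //; lia.
have a0 : a != 0 by rewrite mulf_neq0.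
have b0 : b != 0 by rewrite mulf_neq0.
pose D := ((t2 - t1)./2)%N.
have t2E : t2 = (t1 + 2 * D)%N.
  by rewrite /D mul2n halfK oddB 1?ltnW // todd addbb subn0 subnKC // ltnW.
have Dp : (0 < D)%N by lia.
pose G := g%:Z ^+ D.
have G2 : 2 <= G.
  rewrite /G -[D]prednK // exprS -[2]mulr1.
  by apply: ler_pM => //; apply: exprn_ege1; clear -g2; lia.
have e2' : y2%:Z ^+ 2 = a + g%:Z ^+ t1 * G ^+ 2 * b.
  by rewrite e2 t2E exprD mulnC exprM.
have bnd : g%:Z ^+ t1 <= 2 * `|a| ^+ 2 * G ^+ 2.
  by apply: two_squares_bound e1 e2'; rewrite ?exprn_gt0.
have ale : `|a| <= g%:Z ^+ (1 + `|c|).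
  rewrite /a normrM normrX exprD ler_pM ?exprn_ge0 //.
    by rewrite ger0_norm //; case: (odd h); rewrite ?expr1 ?expr0 //; clear -gp; lia.
  have : (`|c| < g ^ `|c|)%N by rewrite ltn_expl.
  rewrite -ltz_nat -[X in _ < X]natz natrX natz => /ltW.
  by rewrite abszE.
(* The three summands of the exponent account for [2 <= g], for [|a| ^+ 2] and for [G ^+ 2]. As
   [2 * D] is [t2 - t1], the first two make up the constant [2 * |c| + 3]. *)
have bnd2 : g%:Z ^+ t1 <= g%:Z ^+ (1 + 2 * (1 + `|c|) + 2 * D).
  apply: (le_trans bnd).
  rewrite 2!exprD ![(2 * _)%N]mulnC (exprM _ (1 + _)) (exprM _ D) -/G expr1.
  rewrite ler_pM ?mulr_ge0 ?exprn_ge0 //.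
  by apply: ler_pM => //; rewrite ?exprn_ge0 ?lez_nat ?lerXn2r // nnegrE exprn_ge0.
by move: bnd2; rewrite ler_eXn2l; clear -g2 t2E; lia.
Qed.

(** Until it is empty, the set loses an element at every step. It will be applied to the indices
    whose exponents lie beyond a threshold that moves outwards with [r]. *)
Lemma shrinking_chain (T : finType) (J : nat -> {set T}) :
  (forall r, J r.+1 \subset J r) -> (forall r, J r.+1 = J r -> J r = finset.set0) ->
  J #|T| = finset.set0.
Proof.
move=> sub stop.
have H r : (#|J r| <= #|T| - r)%N.
  elim: r => [|r IH]; first by rewrite subn0 max_card.
  have [e|ne] := eqVneq (J r.+1) (J r).
    by rewrite e (stop _ e) cards0.
  have : (#|J r.+1| < #|J r|)%N by apply: proper_card; rewrite finset.properEneq ne sub.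
  lia.
by apply/eqP; rewrite -cards_eq0 -leqn0 (leq_trans (H _)) // subnn.
Qed.

(** Each [t] determines at most one [x], so it suffices to count the exponents [t]. Those of one
    parity have doubling gaps, and the leading 2 counts the parities. If [B] vanishes the equation
    does not involve [t], which is then pinned to 0. [K] is the scaling that clears denominators. *)
Lemma card_fixed_tail (g K h N E n : nat) (c B : int) (A : {set 'I_N.+1}) :
  (2 <= g)%N -> (0 < K)%N -> c != 0 -> (E <= 2 ^ n)%N ->
  (forall x, x \in A -> (0 < x)%N /\ exists2 t : 'I_E, (B != 0) || (t == 0%N :> nat) &
     (x * K)%:Z ^+ 2 = g%:Z ^+ h * (c + g%:Z ^+ t * B)) ->
  (#|A| <= 2 * (2 * `|c| + 3 + 1 + n))%N.
Proof.
move=> g2 K0 c0 En hA.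
pose eqn (x : 'I_N.+1) (t : 'I_E) :=
  (x * K)%:Z ^+ 2 == g%:Z ^+ h * (c + g%:Z ^+ t * B).
pose T b := [set t : 'I_E | [&& odd t == b, (B != 0) || (t == 0%N :> nat) &
   [exists x in A, eqn x t]]].
pose f (t : 'I_E) : 'I_N.+1 := odflt ord0 [pick x in A | eqn x t].
have eqn_inj x y t : eqn x t -> eqn y t -> x = y.
  move=> /eqP ex /eqP ey; apply: val_inj.
  have : (x * K)%:Z ^+ 2 = (y * K)%:Z ^+ 2 by rewrite ex ey.
  move/eqP; rewrite eqrXn2 // => /eqP[] /eqP.
  by rewrite eqn_pmul2r // => /eqP.
have sub : A \subset [set f t | t in T true] :|: [set f t | t in T false].
  apply/fintype.subsetP => x xA; have [x0 [t tB /eqP e]] := hA x xA.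
  have ft : f t = x.
    rewrite /f; case: pickP => [y /andP[_ ey]|/(_ x)]; last by rewrite xA /eqn e.
    by apply: (eqn_inj _ _ t) => //; rewrite /eqn e.
  have tT : t \in T (odd t).
    by rewrite inE eqxx tB; apply/existsP; exists x; rewrite xA /eqn e.
  by rewrite inE -ft; case: (odd t) tT => tT; rewrite !(imset_f f tT) ?orbT.
have cardT b : (#|T b| <= 2 * `|c| + 3 + 1 + n)%N.
  (* The added condition is automatic, because [t < E <= 2 ^ n]. *)
  have -> : T b = [set t in T b | (t < (2 * `|c| + 3) + 2 ^ n)%N].
    by apply/setP=> t; rewrite !inE; case: t => /= t tE; lia.
  apply: card_doubling => s t.
  rewrite !inE => /and3P[/eqP sb sB /existsP[x /andP[xA /eqP ex]]].
  move=> /and3P[/eqP tb tB /existsP[y /andP[yA /eqP ey]]] st.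
  (* With [B = 0] both exponents would be 0, against [s < t]. *)
  have B0 : B != 0 by case/orP: tB => // /eqP t0; move: st; rewrite t0.
  have [x0 _] := hA x xA; have [y0 _] := hA y yA.
  by apply: square_gap ex ey; rewrite ?muln_gt0 ?x0 ?y0 //; congruence.
apply: (leq_trans (subset_leq_card sub)).
apply: (leq_trans (leq_card_setU _ _)).
by rewrite mul2n -addnn leq_add // (leq_trans (leq_imset_card _ _)).
Qed.

(** * Size and divisibility of sums of terms c_i g^(k_i) *)

Section RatSums.
Variables (m : nat) (c : 'I_m -> int) (g : nat).
Hypothesis g2 : (2 <= g)%N.
Let M := (\sum_i `|c i|)%N.
Let gq : rat := g%:R.
Let w (k : 'I_m -> int) i : rat := (c i)%:~R * gq ^ k i.

Let gq_gt1 : 1 < gq. Proof. by rewrite /gq ltr1n. Qed.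
Let gq_gt0 : 0 < gq. Proof. exact: lt_trans gq_gt1. Qed.
Let gq_neq0 : gq != 0. Proof. by rewrite gt_eqF. Qed.

Lemma sum_le (J : {set 'I_m}) k (a : int) : (forall i, i \in J -> k i <= a) ->
  `|\sum_(i in J) w k i| <= M%:R * gq ^ a.
Proof.
move=> ka; apply: (le_trans (ler_norm_sum _ _ _)).
apply: (@le_trans _ _ (\sum_(i in J) `|c i|%N%:R * gq ^ a)).
  apply: ler_sum => i iJ; rewrite normrM ler_pM //.
    by rewrite -intr_norm -abszE pmulrn.
  by rewrite gtr0_norm ?exprz_gt0 // ler_eXz2l // ka.
rewrite -mulr_suml ler_wpM2r ?exprz_ge0 ?(ltW gq_gt0) //.
rewrite -natr_sum ler_nat /M [X in (_ <= X)%N](bigID (mem J)) /=.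
exact: leq_addr.
Qed.

Lemma sum_multiple (J : {set 'I_m}) k (a : int) :
  (forall i, i \in J -> a <= k i) ->
  exists z : int, \sum_(i in J) w k i = z%:~R * gq ^ a.
Proof.
move=> ak; exists (\sum_(i in J) c i * g%:Z ^+ `|k i - a|).
rewrite rmorph_sum /= mulr_suml; apply: eq_bigr => i iJ.
rewrite /w rmorphM rmorphXn /= -mulrA; congr (_ * _).
rewrite -[X in X ^+ _]/gq exprnP abszE ger0_norm ?subr_ge0 ?ak //.
by rewrite -expfzDr // subrK.
Qed.

Lemma multiple_ge (z a : int) : z != 0 -> gq ^ a <= `|z%:~R * gq ^ a|.
Proof.
move=> z0; rewrite normrM [X in _ * X]gtr0_norm ?exprz_gt0 //.
rewrite ler_peMl ?exprz_ge0 ?(ltW gq_gt0) // -intr_norm -[1]/(1%:~R) ler_int.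
by rewrite -gtz0_ge1 normr_gt0.
Qed.

(** The sum is an integer multiple of g^a, and a nonzero one is at least g^a in absolute value. *)
Lemma sum_ge (J : {set 'I_m}) k (a : int) :
  (forall i, i \in J -> a <= k i) -> \sum_(i in J) w k i != 0 ->
  gq ^ a <= `|\sum_(i in J) w k i|.
Proof.
move=> /sum_multiple[z ->] ne; apply: multiple_ge.
by apply: contraNneq ne => ->; rewrite mul0r.
Qed.

End RatSums.

(** * Confining the exponents to a window *)

Lemma bounded_representation (m : nat) (c : 'I_m -> int) (g n l : nat) :
  (2 <= g)%N -> (0 < n)%N -> (n ^ 2 <= g ^ l)%N -> sparse_square c g n ->
  let C := (\sum_i `|c i|).+1 in
  exists (I : {set 'I_m}) (e : 'I_m -> nat),
    [/\ exists i, i \in I,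
        forall i, i \in I -> c i != 0 /\ (e i <= l + 3 * (C * m))%N &
        (n * g ^ (C * m))%:Z ^+ 2 = \sum_(i in I) c i * g%:Z ^+ e i].
Proof.
move=> g2 n0 nl sq C.
pose gq : rat := g%:R.
have gq1 : 1 < gq by rewrite /gq ltr1n.
have gq0 : 0 < gq by exact: lt_trans gq1.
have gqn : gq != 0 by rewrite gt_eqF.
pose w (k : 'I_m -> int) i : rat := (c i)%:~R * gq ^ k i.
pose P (I : {set 'I_m}) := `[< exists k, (n%:R : rat) ^+ 2 = \sum_(i in I) w k i >].
have PT : P finset.setT.
  apply/asboolP; case: sq => k ->; exists k.
  by apply: eq_bigl => i; rewrite inE.
case: (arg_minnP (fun I : {set 'I_m} => #|I|) PT) => I /asboolP[k eI] Imin.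
(* The minimality of [I] forbids vanishing subsums. *)
have nz (J : {set 'I_m}) : J \subset I -> J != finset.set0 -> \sum_(i in J) w k i != 0.
  move=> JI J0; apply/eqP => s0.
  have : P (I :\: J).
    apply/asboolP; exists k; rewrite eI (big_setID J) /= (finset.setIidPr JI) s0.
    by rewrite add0r.
  move/Imin; rewrite cardsD (finset.setIidPr JI).
  have : (#|J| <= #|I|)%N by exact: subset_leq_card.
  by have : (0 < #|J|)%N by [rewrite card_gt0]; lia.
have gC : (C < g ^ C)%N by rewrite ltn_expl.
(* A gap of length [C] between exponents outweighs all coefficients together, with 1 to spare for
   the term n^2. *)
have gCq : (\sum_i `|c i|)%N%:R + 1 < gq ^ C.
  by rewrite natr1 -exprnP /gq -natrX ltr_nat.
pose B := (\sum_i `|c i|)%N; rewrite -/B in gCq.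
have nq : (n%:R : rat) ^+ 2 <= gq ^ l by rewrite -exprnP /gq -!natrX ler_nat.
(* If no exponent lies between two consecutive thresholds, the terms above have a nonzero sum of
   size at least g^(l + C(r + 1)). It equals n^2 minus the other terms, which is at most (B + 1)
   g^(l + C r), a contradiction. *)
have hi i : i \in I -> k i <= (l + C * m)%N%:Z.
  pose J r := [set i in I | (l + C * r)%N%:Z < k i].
  have JI r : J r \subset I by apply/fintype.subsetP => j; rewrite inE => /andP[].
  have Jm : J #|'I_m| = finset.set0.
    apply: shrinking_chain => r.
      apply/fintype.subsetP => j; rewrite !inE => /andP[->] /=; rewrite mulnS; lia.
    move=> eJ; apply/eqP/negPn/negP => J0.
    have := nz _ (JI r) J0; rewrite -eJ => /(sum_ge g2) H.
    have {H} := H (l + C * r.+1)%N%:Z.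
    have Jin j : j \in J r.+1 -> (l + C * r.+1)%N%:Z <= k j.
      by rewrite inE => /andP[_ /ltW].
    move=> /(_ Jin); rewrite eJ.
    have -> : \sum_(i in J r) w k i = n%:R ^+ 2 - \sum_(i in I :\: J r) w k i.
      by rewrite eI [in RHS](big_setID (J r)) /= (finset.setIidPr (JI r)) addrK.
    have : `|\sum_(i in I :\: J r) w k i| <= B%:R * gq ^ (l + C * r)%N.
      apply: (@sum_le m c g g2 _ k) => j; rewrite inE => /andP[+ jI].
      by rewrite inE jI /= -leNgt.
    move=> H1 H2; have := le_trans H2 (ler_normB _ _).
    have : (n%:R : rat) ^+ 2 <= gq ^ (l + C * r)%N.
      by apply: (le_trans nq); rewrite ler_eXz2l // lez_nat leq_addr.
    have : (B%:R + 1) * gq ^ (l + C * r)%N < gq ^ (l + C * r.+1)%N.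
      have -> : (l + C * r.+1)%N%:Z = C%:Z + (l + C * r)%N%:Z.
        by rewrite mulnS addnCA PoszD.
      rewrite expfzDr // ltr_pM2r //.
      exact: exprz_gt0.
    rewrite mulrDl mul1r ger0_norm ?sqr_ge0 // -/gq.
    clear - H1; lra.
  move=> iI; rewrite leNgt; apply/negP => ki.
  have : i \in J #|'I_m| by rewrite inE iI card_ord.
  by rewrite Jm inE.
(* The dual argument: the low terms sum to n^2 minus multiples of g^(-C r), hence to a nonzero
   multiple of g^(-C r), yet their size is at most B g^(-C(r + 1)). *)
have lo i : i \in I -> - (C * m)%N%:Z <= k i.
  pose J r := [set i in I | k i < - (C * r)%N%:Z].
  have JI r : J r \subset I by apply/fintype.subsetP => j; rewrite inE => /andP[].
  have Jm : J #|'I_m| = finset.set0.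
    apply: shrinking_chain => r.
      apply/fintype.subsetP => j; rewrite !inE => /andP[->] /=; rewrite mulnS; lia.
    move=> eJ; apply/eqP/negPn/negP => J0.
    have [z ez] : exists z : int, \sum_(i in J r) w k i = z%:~R * gq ^ (- (C * r)%N%:Z).
      have [z ez] : exists z : int,
          \sum_(i in I :\: J r) w k i = z%:~R * gq ^ (- (C * r)%N%:Z).
        apply: (@sum_multiple m c g g2 _ k) => j; rewrite inE => /andP[+ jI].
        by rewrite inE jI /= -leNgt.
      exists (n%:Z ^+ 2 * g%:Z ^+ (C * r) - z).
      rewrite rmorphB rmorphM !rmorphXn /= mulrBl -ez -mulrA.
      rewrite [X in _ * X](_ : _ = 1); last first.
        by rewrite exprnP -/gq -expfzDr // subrr expr0z.
      have -> : (n%:Z%:~R : rat) = n%:R by [].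
      by rewrite mulr1 eI [in RHS](big_setID (J r)) /= (finset.setIidPr (JI r)) addrK.
    have z0 : z != 0.
      by apply: contraNneq (nz _ (JI r) J0) => z0; rewrite ez z0 mul0r.
    have := multiple_ge g2 (- (C * r)%N%:Z) z0; rewrite -/gq -ez.
    have : `|\sum_(i in J r) w k i| <= B%:R * gq ^ (- (C * r.+1)%N%:Z).
      apply: (@sum_le m c g g2 _ k) => j; rewrite -eJ inE => /andP[_].
      exact: ltW.
    move=> H1 H2; have := le_trans H2 H1.
    have -> : - (C * r)%N%:Z = C%:Z + - (C * r.+1)%N%:Z by rewrite mulnS; lia.
    rewrite expfzDr // ler_pM2r ?exprz_gt0 //; clear - gCq; lra.
  move=> iI; rewrite leNgt; apply/negP => ki.
  have : i \in J #|'I_m| by rewrite inE iI card_ord.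
  by rewrite Jm inE.
(* The shift by [2 * (C * m)] makes the exponents nonnegative; being even, it keeps the left-hand
   side a square. *)
exists I, (fun i => absz (k i + (2 * (C * m))%N)); split.
- apply/set0Pn; apply/eqP => I0; move: eI; rewrite I0 big_set0 => /eqP.
  by rewrite expf_eq0 /= pnatr_eq0; move: n0; case: (n).
- move=> i iI; split; last first.
    by have := lo i iI; have := hi i iI; lia.
  apply: contraTneq isT => ci.
  have := nz (finset.set1 i); rewrite finset.sub1set iI => /(_ isT).
  rewrite -finset.card_gt0 cards1 => /(_ isT).
  by rewrite big_set1 /w ci mul0r eqxx.
apply: (@intr_inj rat).
rewrite rmorphXn rmorph_sum /=.
have -> : ((n * g ^ (C * m))%N%:Z%:~R : rat) ^+ 2 = n%:R ^+ 2 * gq ^ (2 * (C * m))%N.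
  by rewrite -pmulrn natrM exprMn natrX -exprM mulnC.
rewrite eI mulr_suml; apply: eq_bigr => i iI.
rewrite rmorphM rmorphXn /= /w -mulrA -expfzDr //; congr (_ * _).
rewrite exprnP -/gq abszE ger0_norm //.
by have := lo i iI; lia.
Qed.

(** * Counting the representations *)

Lemma card_bigcup_le (I T : finType) (P : {pred I}) (F : I -> {set T}) k :
  (forall i, i \in P -> (#|F i| <= k)%N) ->
  (#|(\bigcup_(i in P) F i)%SET| <= #|P| * k)%N.
Proof.
move=> Fk; rewrite -sum_nat_const.
apply: (@leq_trans (\sum_(i in P) #|F i|)%N); last exact: leq_sum.
elim/big_rec2: _ => [|i n A _ IH]; first by rewrite finset.cards0.
by apply: (leq_trans (leq_card_setU _ _)); rewrite leq_add2l.
Qed.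

(** [i0] carries the least exponent and [i1] the next one; [t] is the gap between them, and the
    exponents other than that of [i0] are measured from [i1]. The normalisation [f i1 = ord0] leaves
    only [m - 1] free values of [f]. *)
Lemma separated_form (m : nat) (c : 'I_m -> int) (g E : nat) (I : {set 'I_m})
    (e : 'I_m -> nat) :
  (2 <= m)%N -> (exists i, i \in I) -> (forall i, i \in I -> (e i <= E)%N) ->
  exists i0 i1 (f : {ffun 'I_m -> 'I_E.+1}) (t : 'I_E.+1),
    let B := \sum_(i in I | i != i0) c i * g%:Z ^+ f i in
    [/\ i0 \in I, f i1 = ord0, (B != 0) || (t == 0%N :> nat) &
      \sum_(i in I) c i * g%:Z ^+ e i = g%:Z ^+ f i0 * (c i0 + g%:Z ^+ t * B)].
Proof.
move=> m2 [i iI] eE.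
case: (arg_minnP e iI) => i0 i0I e0min {i iI}.
suff [i1 [f [t [f1 f0 eB]]]] : exists i1 (f : {ffun 'I_m -> 'I_E.+1}) (t : 'I_E.+1),
    [/\ f i1 = ord0, f i0 = e i0 :> nat &
      \sum_(i in I | i != i0) c i * g%:Z ^+ e i =
      g%:Z ^+ e i0 * (g%:Z ^+ t * \sum_(i in I | i != i0) c i * g%:Z ^+ f i)].
  have eS : \sum_(i in I) c i * g%:Z ^+ e i = g%:Z ^+ f i0 *
      (c i0 + g%:Z ^+ t * \sum_(i in I | i != i0) c i * g%:Z ^+ f i).
    by rewrite (bigD1 i0) //= eB f0; ring.
  have [B0|B0] := eqVneq (\sum_(i in I | i != i0) c i * g%:Z ^+ f i) 0.
    exists i0, i1, f, ord0; split=> //; first by rewrite B0 eqxx.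
    by rewrite eS B0 !mulr0.
  by exists i0, i1, f, t; split=> //; rewrite B0.
have [/existsP[i /andP[iI ii0]]|none] := boolP [exists i, (i \in I) && (i != i0)].
  have iP : (i \in I) && (i != i0) by rewrite iI.
  case: (@arg_minnP _ i (fun i => (i \in I) && (i != i0)) e iP) => i1 /andP[i1I i10] e1min {i iI ii0 iP}.
  exists i1, [ffun i => inord (if i == i0 then e i0 else e i - e i1)%N].
  exists (inord (e i1 - e i0)%N).
  split.
  - by apply: val_inj; rewrite ffunE (negPf i10) subnn /= inordK.
  - by rewrite ffunE eqxx inordK // ltnS eE.
  rewrite inordK; last by have := eE _ i1I; lia.
  rewrite mulrA -exprD subnKC; last exact: e0min.
  rewrite mulr_sumr; apply: eq_bigr => i /andP[iI ii0].
  rewrite ffunE (negPf ii0) inordK; last by have := eE _ iI; lia.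
  rewrite mulrCA -exprD subnKC //; apply: e1min.
  by rewrite iI.
(* With a single term there is no second exponent, so [i1] is any other index, available since
   [m >= 2]. *)
have [i1 i10] : exists i1, i1 != i0.
  have /card_gt1P[x [y [_ _ xy]]] : (1 < #|'I_m|)%N by rewrite card_ord.
  have [xi|] := eqVneq x i0; last by exists x.
  by exists y; rewrite -xi eq_sym.
exists i1, [ffun i => inord (if i == i0 then e i0 else 0)%N], ord0; split.
- by apply: val_inj; rewrite ffunE (negPf i10) /= inordK.
- by rewrite ffunE eqxx inordK // ltnS eE.
have none' i : (i \in I) && (i != i0) = false.
  by apply: contraNF none => h; apply/existsP; exists i.
by rewrite !big_pred0 // !mulr0.
Qed.

(** The factors count the choices of [I], [i0], [i1] and [f] with [f i1 = 0], and then the integers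
    left once these are fixed. *)
Lemma sparse_square_count_le (m : nat) (c : 'I_m -> int) (g N l n : nat) :
  (2 <= m)%N -> (2 <= g)%N -> (N ^ 2 <= g ^ l)%N ->
  let M := (\sum_i `|c i|)%N in let E := (l + 3 * (M.+1 * m)).+1 in
  (E <= 2 ^ n)%N ->
  (sparse_square_count c g N <=
    2 ^ m * (m * (m * (E ^ m.-1 * (2 * (2 * M + 3 + 1 + n))))))%N.
Proof.
move=> m2 g2 Nl M E En.
pose K := (g ^ (M.+1 * m))%N.
have K0 : (0 < K)%N by rewrite expn_gt0; lia.
pose B (I : {set 'I_m}) i0 (f : {ffun 'I_m -> 'I_E}) :=
  \sum_(i in I | i != i0) c i * g%:Z ^+ f i.
pose F I i0 f : {set 'I_N.+1} := [set x : 'I_N.+1 | [&& (0 < x)%N, c i0 != 0 &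
  [exists t : 'I_E, ((B I i0 f != 0) || (t == 0%N :> nat)) &&
    ((x * K)%:Z ^+ 2 == g%:Z ^+ f i0 * (c i0 + g%:Z ^+ t * B I i0 f))]]].
have cardF I i0 f : (#|F I i0 f| <= 2 * (2 * M + 3 + 1 + n))%N.
  have [c0|c0] := eqVneq (c i0) 0.
    rewrite (_ : F _ _ _ = finset.set0) ?finset.cards0 //.
    by apply/setP => x; rewrite !inE c0 eqxx andbF.
  have cM : (`|c i0| <= M)%N by rewrite /M (bigD1 i0) //= leq_addr.
  apply: (@leq_trans (2 * (2 * `|c i0| + 3 + 1 + n))%N); last first.
    by rewrite leq_mul2l !leq_add2r leq_mul2l cM.
  apply: (@card_fixed_tail g K (f i0) N E n (c i0) (B I i0 f)) => // x.
  rewrite inE => /and3P[x0 _ /existsP[t /andP[tB /eqP ex]]].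
  by split=> //; exists t.
rewrite /sparse_square_count.
set A := (X in (#|X| <= _)%N).
have sub : A \subset (\bigcup_(I in predT) \bigcup_(i0 in predT)
    \bigcup_(i1 in predT) \bigcup_(f in pffun_on ord0 (predC1 i1) predT) F I i0 f)%SET.
  apply/fintype.subsetP => x; rewrite inE => /andP[x0 /asboolP sx].
  have xN : (x ^ 2 <= g ^ l)%N.
    by apply: (leq_trans _ Nl); rewrite leq_exp2r // -ltnS.
  have [I [e [I0 cI ex]]] := bounded_representation g2 x0 xN sx.
  have eE i : i \in I -> (e i <= l + 3 * (M.+1 * m))%N by move=> /cI[].
  have [i0 [i1 [f [t [i0I f1 tB eS]]]]] := separated_form c g m2 I0 eE.
  apply/finset.bigcupP; exists I => //.
  apply/finset.bigcupP; exists i0 => //.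
  apply/finset.bigcupP; exists i1 => //.
  apply/finset.bigcupP; exists f.
    apply/pffun_onP; split=> //; apply/supportP => i.
    by rewrite !inE negbK => /eqP ->.
  rewrite inE x0 (cI _ i0I).1 /=; apply/existsP; exists t.
  by rewrite tB -eS ex eqxx.
apply: (leq_trans (subset_leq_card sub)).
have -> : (2 ^ m = #|{set 'I_m}|)%N by rewrite -cardsT -powersetT card_powerset cardsT card_ord.
apply: card_bigcup_le => I _.
rewrite -[X in (_ <= X * _)%N]card_ord; apply: card_bigcup_le => i0 _.
rewrite -[X in (_ <= X * _)%N]card_ord; apply: card_bigcup_le => i1 _.
have -> : (E ^ m.-1 = #|pffun_on (ord0 : 'I_E) (predC1 i1) predT|)%N.
  by rewrite card_pffun_on cardC1 !card_ord.
by apply: card_bigcup_le => f _.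
Qed.

(** Cubing turns the saving of 2/3 in the exponent into the integer 2, so that everything stays in
    [nat]. *)
Lemma sparse_square_count_cube_le (m : nat) (c : 'I_m -> int) (g : nat) :
  (2 <= m)%N -> (2 <= g)%N ->
  exists K : nat, forall N : nat, (2 <= N)%N ->
    (sparse_square_count c g N ^ 3 <= K * up_log 2 N ^ (3 * m - 2))%N.
Proof.
move=> m2 g2.
pose M := (\sum_i `|c i|)%N; pose K1 := (2 ^ m * (m * m))%N.
pose K2 := (3 + 3 * (M.+1 * m))%N; pose a := (2 * M + 3 + 1)%N.
exists (K1 ^ 3 * (64 * 2 ^ a) * K2 ^ (3 * m - 2))%N => N N2.
set u := up_log 2 N.
have u0 : (0 < u)%N by rewrite up_log_gt0.
pose E := (2 * u + 3 * (M.+1 * m)).+1.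
pose n := up_log 2 E.
have Nu : (N ^ 2 <= g ^ (2 * u))%N.
  rewrite mulnC expnM leq_exp2r // (leq_trans (up_logP N (ltnSn 1))) //.
  by rewrite leq_exp2r.
have := sparse_square_count_le m2 g2 Nu (up_logP E (ltnSn 1)).
rewrite -/M -/E -/n -/a => H.
have EK : (E <= K2 * u)%N by rewrite /E /K2; nia.
(* Here [2 ^ n < 2 * E], and the constant is 64 = 8 * 4 * 2. *)
have cube : ((2 * (a + n)) ^ 3 <= 64 * 2 ^ a * E)%N.
  have E1 : (1 < E)%N by rewrite /E; lia.
  have : (2 ^ n < 2 * E)%N.
    have n0 : (0 < n)%N by rewrite up_log_gt0.
    by rewrite -(prednK n0) expnS ltn_mul2l /= up_log_gtn.
  have := cube_le_exp2 (a + n); rewrite expnMn expnD.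
  have : (0 < 2 ^ a)%N by rewrite expn_gt0.
  clear; nia.
have E3 : (E ^ (3 * m - 2) = (E ^ m.-1) ^ 3 * E)%N.
  by rewrite -expnM -expnSr; congr (_ ^ _)%N; lia.
apply: (@leq_trans (K1 ^ 3 * (64 * 2 ^ a) * E ^ (3 * m - 2))%N); last first.
  by rewrite -[leqRHS]mulnA -expnMn leq_mul2l leq_exp2r ?EK ?orbT //; lia.
apply: (@leq_trans ((K1 * E ^ m.-1 * (2 * (a + n))) ^ 3)%N).
  by rewrite leq_exp2r // (leq_trans H) // /K1 !mulnA.
rewrite E3 expnMn [((_ * E ^ m.-1) ^ 3)%N]expnMn.
by rewrite [leqRHS]mulnACA leq_mul.
Qed.

(** * Passage to real powers of log N *)

(** For [m] other than 3 the value stays below 677/1323. The bound 7/12 is chosen below 2/3 so that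
    2 - 3 * 7/12 = 1/4 is a convenient margin. *)
Lemma gamma_exp_le (R : realType) (m : nat) : gamma_exp R m <= 7%:R / 12%:R.
Proof.
rewrite /gamma_exp; case: eqP => _; first by lra.
have m0 : 0 <= m%:R :> R by [].
by rewrite ler_pdivrMr; lra.
Qed.

Lemma up_log_le_ln (R : realType) (N : nat) : (3 <= N)%N ->
  (up_log 2 N)%:R <= 2 / ln 2 * ln (N%:R : R).
Proof.
move=> N3; set u := up_log 2 N.
have ln2 : 0 < ln (2 : R) by rewrite ln_gt0 // ltr1n.
have u2 : (2 <= u)%N.
  rewrite leqNgt; apply/negP; rewrite ltnS => u1.
  have : (N <= 2 ^ u)%N by exact: up_logP.
  by have : (2 ^ u <= 2 ^ 1)%N by [rewrite leq_exp2l]; lia.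
have : (u.-1)%:R * ln 2 <= ln (N%:R : R).
  rewrite mulr_natl -lnXn // ler_ln ?posrE ?exprn_gt0 // ?ltr0n; last by lia.
  by rewrite -natrX ler_nat ltnW // up_log_gtn //; lia.
have : (u%:R : R) <= 2 * u.-1%:R by rewrite -natrM ler_nat; lia.
move=> h1 h2; rewrite mulrAC ler_pdivlMr //.
by apply: (le_trans (ler_wpM2r (ltW ln2) h1)); rewrite -mulrA ler_pM2l.
Qed.

Local Open Scope classical_set_scope.
Local Open Scope ring_scope.

Theorem theorem1p2 (R : realType) (m : nat) (c : 'I_m -> int) (g : int)
    (hm : (3 <= m)%N) (hg : 2 <= g) :
  exists eps : nat -> R,
    eps @ \oo --> (0 : R) /\
    \forall N \near \oo,
      (sparse_square_count c g N)%:R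
        <= (ln (N%:R : R)) `^ (m%:R - gamma_exp R m + eps N).
Proof.
case: g hg => // g hg; exists (fun=> 0); split; first exact: cvg_cst.
have [K HK] := sparse_square_count_cube_le c (ltnW hm) hg.
pose A : R := K%:R * (2 / ln 2) ^+ (3 * m - 2).
near=> N.
have N3 : (3 <= N)%N by near: N; exists 3%N.
pose L : R := ln N%:R.
(* This threshold on [N] yields both [1 <= L] and [A <= L^(1/4)]; the spare power of [L] then
   swallows the constant [A]. *)
have LA : expR (A ^+ 4 + 1) <= N%:R :> R by near: N; exact: nbhs_infty_ger.
have A0 : 0 <= A by rewrite mulr_ge0 // exprn_ge0 // divr_ge0 // ln_ge0 // ler1n.
have {LA} LA : A ^+ 4 + 1 <= L.
  by rewrite -[X in X <= _]expRK ler_ln ?posrE ?expR_gt0 // ltr0n; lia.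
have A40 : 0 <= A ^+ 4 by rewrite exprn_ge0.
have L1 : 1 <= L by lra.
have L0 : 0 < L by lra.
rewrite addr0 -/L -(@ler_pXn2r _ 3) ?nnegrE ?powR_ge0 //.
have cube : (sparse_square_count c g N)%:R ^+ 3 <= A * L ^+ (3 * m - 2).
  rewrite -natrX; apply: (@le_trans _ _ (K * up_log 2 N ^ (3 * m - 2))%N%:R).
    by rewrite ler_nat HK // ltnW.
  rewrite natrM natrX /A -mulrA ler_wpM2l // -exprMn lerXn2r ?nnegrE //.
    by rewrite mulr_ge0 ?(ltW L0) // divr_ge0 // ln_ge0 // ler1n.
  exact: up_log_le_ln.
apply: (le_trans cube).
rewrite -[leRHS]powR_mulrn ?powR_ge0 // -powRrM.
(* The first summand matches the exponent in [cube]; the second is the margin, at least 1/4. *)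
have -> : (m%:R - gamma_exp R m) * 3 =
    (3 * m - 2)%N%:R + (2 - 3 * gamma_exp R m) :> R.
  by rewrite natrB ?natrM; [ring | lia].
rewrite powRD; last by apply/implyP => _; rewrite gt_eqF.
rewrite powR_mulrn ?(ltW L0) // mulrC ler_wpM2l ?exprn_ge0 ?(ltW L0) //.
have g4 : 4^-1 <= 2 - 3 * gamma_exp R m by have := gamma_exp_le R m; lra.
apply: le_trans (ler_powR L1 g4).
have -> : A = (A ^+ 4) `^ 4^-1.
  by rewrite -powR_mulrn // -powRrM mulfV // powRr1.
by rewrite ge0_ler_powR ?nnegrE //; lra.
Unshelve. all: by end_near.
Qed.
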